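(* Let $G$ be a finite connected cactus that is not isomorphic to $K_2$. Then the $2$-multigraph ${}^2G$ is locally irregular colorable and satisfies ${\rm lir}({}^2G)\leq 2$; that is, the edges of ${}^2G$ can be colored with at most two colors so that each color induces a locally irregular submultigraph.
   Context: All graphs are finite; $G$ is a simple graph. A cactus is a graph in which no two cycles intersect in more than one vertex (a graph without cycles is allowed). The $2$-multigraph ${}^2G$ is the multigraph obtained from $G$ by doubling each edge, i.e. every edge $uv$ of $G$ is replaced by two parallel single edges, which together form the multiedge $uv$. The degree $\hat d(v)$ of a vertex in a multigraph is the number of single edges incident with $v$. A multigraph is locally irregular if, for every multiedge (every pair of adjacent vertices), the degrees of its two end-vertices are distinct. A locally irregular coloring of a multigraph $M$ is a coloring of its single edges (the two parallel edges of a multiedge may receive the same or different colors; the coloring need not be proper) such that for every color the submultigraph formed by the edges of that color is locally irregular, i.e. whenever at least one single edge joining $u$ and $v$ has color $c$, the numbers of single edges of color $c$ incident with $u$ and with $v$ are different. A multigraph is locally irregular colorable if it admits a locally irregular coloring, and then ${\rm lir}(M)$ denotes the smallest number of colors in such a coloring. *)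

(* Defs.v *)
From mathcomp Require Import all_boot.

Set Implicit Arguments.
Unset Strict Implicit.
Unset Printing Implicit Defensive.

Record sgraph := SGraph {
  svertex :> finType;
  sadj : rel svertex;
  sadj_sym : symmetric sadj;
  sadj_irrefl : irreflexive sadj }.

Definition sedges (G : sgraph) : {set {set G}} :=
  [set [set p.1; p.2] | p : G * G & sadj p.1 p.2].

Lemma sedges_card (G : sgraph) (d : {set G}) : d \in sedges G -> #|d| = 2.
Proof.
case/imsetP=> -[x y]; rewrite inE /= => xy ->; rewrite cards2.
by case: eqVneq xy => // ->; rewrite sadj_irrefl.
Qed.

Definition sgraph_iso (G H : sgraph) : Prop :=
  exists2 f : G -> H, bijective f & {mono f : x y / sadj x y}.

Lemma neq_sym (T : eqType) : symmetric (fun x y : T => x != y).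
Proof. by move=> x y; rewrite eq_sym. Qed.

Lemma neq_irrefl (T : eqType) : irreflexive (fun x y : T => x != y).
Proof. by move=> x; rewrite eqxx. Qed.

Definition complete (n : nat) : sgraph :=
  SGraph (@neq_sym 'I_n) (@neq_irrefl 'I_n).

Definition connected (G : sgraph) : Prop :=
  0 < #|G| /\ forall x y : G, connect (@sadj G) x y.

Definition is_cycle (G : sgraph) (c : seq G) : Prop :=
  2 < size c /\ ucycle (@sadj G) c.

Definition cycle_edges (G : sgraph) (c : seq G) : {set {set G}} :=
  [set [set x; next c x] | x in c].

(* A cycle is a subgraph, whereas a sequence also records a starting point and
   a direction: two sequences are the same cycle iff they have the same edges. *)
Definition cactus (G : sgraph) : Prop :=
  forall c1 c2 : seq G, is_cycle c1 -> is_cycle c2 ->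
    cycle_edges c1 <> cycle_edges c2 ->
    #|[set x in c1] :&: [set x in c2]| <= 1.

(* Loopless multigraph; the elements of [medge] are the single edges, and two
   of them are parallel when they have the same set of ends. *)
Record mgraph := MGraph {
  mvertex : finType;
  medge : finType;
  mends : medge -> {set mvertex};
  mends_card : forall d, #|mends d| = 2 }.

Definition mdeg (M : mgraph) (v : mvertex M) : nat :=
  #|[set d : medge M | v \in mends d]|.

Definition madj (M : mgraph) (u v : mvertex M) : bool :=
  [exists d : medge M, mends d == [set u; v]].

Definition locally_irregular (M : mgraph) : bool :=
  [forall u : mvertex M, forall v : mvertex M,
     madj u v ==> (mdeg u != mdeg v)].

Section Submultigraph.
Variables (M : mgraph) (A : {set medge M}).

Definition sub_ends (d : {d : medge M | d \in A}) : {set mvertex M} :=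
  mends (val d).

Lemma sub_ends_card d : #|sub_ends d| = 2.
Proof. exact: mends_card. Qed.

Definition submgraph : mgraph := MGraph sub_ends_card.
End Submultigraph.

Definition lir_coloring (M : mgraph) (k : nat)
    (col : {ffun medge M -> 'I_k}) : bool :=
  [forall c : 'I_k, locally_irregular (submgraph [set d | col d == c])].

Definition lir_colorable (M : mgraph) : Prop :=
  exists k : nat, [exists col : {ffun medge M -> 'I_k}, lir_coloring col].

Definition lir (M : mgraph) (colM : lir_colorable M) : nat := ex_minn colM.

Section Double.
Variable G : sgraph.

Definition double_ends (d : {d : {set G} | d \in sedges G} * bool) : {set G} :=
  val d.1.

Lemma double_ends_card d : #|double_ends d| = 2.
Proof. exact: sedges_card (valP d.1). Qed.

(* The boolean tells apart the two parallel copies of an edge of G. *)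
Definition doubling : mgraph := MGraph double_ends_card.
End Double.

(* Main.v *)
Require Import Defs.
From mathcomp Require Import all_boot.
From mathcomp Require Import zify.

(* A labelling m of the edges of G by 0, 1, 2 says how many of the two parallel
   edges are red.  The red and the blue degree of a vertex have the same parity,
   so an edge whose ends have red degrees of distinct parities is never bad.
   Give distinct parities to consecutive levels of a breadth-first search.  In a
   cactus the edges inside levels form a matching.  Going through the vertices
   by decreasing level, and treating matched ones together, the edges to the
   parents suffice to get the parities and to make the edge inside the level
   good.  The root then has the right parity by the handshake lemma, provided
   that the number of vertices that should be odd is even, and one of the two
   parity patterns has this property if G has odd order.
   If G has even order, remove a vertex w of maximal level.  It has at most two
   neighbours; root the search in G - w at one of them.  The cactus property
   shows that no neighbour of w lies on an edge inside a level, and labels in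
   {0, 2} on the edges at w can be chosen at the end. *)

Set Implicit Arguments.
Unset Strict Implicit.
Unset Printing Implicit Defensive.

(** * Edge labellings, their sums at vertices, and prescribed parities *)

Section EdgeSums.
Variable T : finType.
Implicit Types (e : rel T) (F m : {set T} -> nat) (s : {set T}).

(** The graph is a bare relation on a fixed type, so that deleting a vertex changes only the
    relation and labellings remain comparable. For [sadj] this is convertible to [sedges]. *)
Definition edges e : {set {set T}} :=
  [set [set p.1; p.2] | p : T * T & e p.1 p.2].

Definition esum e F v := \sum_(s in edges e | v \in s) F s.

(* If m counts red edges, then co m counts the blue ones. *)
Definition co m s := 2 - m s.

(** Local irregularity at one edge, first for red and then for blue: a red copy exists when the
    label is not 0, a blue one when it is not 2. *)
Definition good e m u v :=
  ((m [set u; v] != 0) ==> (esum e m u != esum e m v)) &&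
  ((m [set u; v] != 2) ==> (esum e (co m) u != esum e (co m) v)).

Definition upd x y k F s := if s == [set x; y] then k else F s.

Lemma set2_inj (x y z : T) : [set x; y] = [set x; z] -> y = z.
Proof.
move=> E; have: y \in [set x; z] by rewrite -E set22.
have: z \in [set x; y] by rewrite E set22.
by rewrite !inE => /orP[/eqP->|/eqP->//] /orP[/eqP->|/eqP].
Qed.

Lemma mem_edges e u v : symmetric e -> ([set u; v] \in edges e) = e u v.
Proof.
move=> sym_e; apply/imsetP/idP=> [[[x y]]|euv]; last first.
  by exists (u, v); rewrite ?inE.
rewrite inE /= => exy E.
have: u \in [set x; y] by rewrite -E set21.
rewrite !inE => /orP[]/eqP ux; subst u; first by rewrite (set2_inj E).
by rewrite (@set2_inj y v x) 1?sym_e // E setUC.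
Qed.

Lemma good_sym e m : symmetric (good e m).
Proof.
move=> u v; rewrite /good setUC (eq_sym (esum e m u)).
by rewrite (eq_sym (esum e (co m) u)).
Qed.

Lemma eq_esum e F1 F2 v : F1 =1 F2 -> esum e F1 v = esum e F2 v.
Proof. by move=> eqF; apply: eq_bigr => s _. Qed.

(** Every edge at [v] contributes exactly 2 to the red and blue sums together. *)
Lemma odd_esum_co e m v :
  (forall s, m s <= 2) -> odd (esum e (co m) v) = odd (esum e m v).
Proof.
move=> m2; suff: ~~ odd (esum e (co m) v + esum e m v).
  by rewrite oddD; case: odd; case: odd.
rewrite -big_split.
apply: (big_ind (fun n => ~~ odd n)) => // [x y /negbTE ox /negbTE oy|s _].
  by rewrite oddD ox oy.
by rewrite /= subnK.
Qed.

Lemma good_odd e m u v : (forall s, m s <= 2) ->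
  odd (esum e m u) != odd (esum e m v) -> good e m u v.
Proof.
move=> m2 uv; apply/andP; split; apply/implyP=> _; apply: contra uv => /eqP E.
  by rewrite E.
by rewrite -!(odd_esum_co e _ m2) E.
Qed.

Lemma co_upd x y k m : co (upd x y k m) =1 upd x y (2 - k) (co m).
Proof. by move=> s; rewrite /co /upd; case: eqP. Qed.

Lemma esum_upd_notin e x y k F v :
  v \notin [set x; y] -> esum e (upd x y k F) v = esum e F v.
Proof.
move=> vxy; apply: eq_bigr => s /andP[_ vs]; rewrite /upd.
by case: eqP vs => // ->; rewrite (negbTE vxy).
Qed.

(** Label 0 serves as the reference value: it isolates the part of the sum that does not depend on
    the edge being relabelled. *)
Lemma esum_upd_in e x y k F v : [set x; y] \in edges e -> v \in [set x; y] ->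
  esum e (upd x y k F) v = esum e (upd x y 0 F) v + k.
Proof.
move=> exy vxy; rewrite /esum.
rewrite (bigD1 [set x; y]) ?exy //= [in RHS](bigD1 [set x; y]) ?exy //=.
rewrite /upd !eqxx add0n addnC; congr (_ + _).
by apply: eq_bigr => s /andP[_ /negbTE->].
Qed.

Lemma esum_local e F1 F2 v : (forall s, v \in s -> F1 s = F2 s) ->
  esum e F1 v = esum e F2 v.
Proof. by move=> eqF; apply: eq_bigr => s /andP[_]; apply: eqF. Qed.

Lemma esum_upd2 e x y z j k F : symmetric e -> e x y -> e x z -> y != z ->
  esum e (upd x y k (upd x z j F)) x =
  esum e (upd x y 0 (upd x z 0 F)) x + j + k.
Proof.
move=> sym_e exy exz nyz.
have updC i : upd x y 0 (upd x z i F) =1 upd x z i (upd x y 0 F).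
  move=> s; rewrite /upd; case: eqP => // ->; case: eqP => // /set2_inj E.
  by rewrite E eqxx in nyz.
rewrite esum_upd_in ?set21 ?mem_edges // !(eq_esum _ _ (updC _)).
by rewrite (esum_upd_in j) ?set21 ?mem_edges.
Qed.

Lemma handshake e m : symmetric e -> irreflexive e ->
  ~~ odd (\sum_v esum e m v).
Proof.
move=> sym_e irr_e; rewrite /esum.
rewrite (exchange_big_dep (mem (edges e))) /=; last by move=> ? ? _ /andP[].
apply: (big_ind (fun n => ~~ odd n)) => // [x y /negbTE ox /negbTE oy|s].
  by rewrite oddD ox oy.
case/imsetP=> -[x y]; rewrite inE /= => exy ->.
rewrite (eq_bigl (mem [set x; y])); last first.
  move=> v; rewrite mem_edges // exy //.
rewrite sum_nat_const cards2; case: eqVneq exy => [->|_ _].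
  by rewrite irr_e.
by rewrite oddM.
Qed.

Lemma esum_nbr e F v : symmetric e ->
  esum e F v = \sum_(u | e v u) F [set v; u].
Proof.
move=> sym_e; rewrite /esum.
rewrite -(@big_imset _ _ _ _ _ (fun u => [set v; u]) [pred u | e v u]) /=.
  apply: eq_bigl => s; apply/andP/imsetP=> [[]|[u evu ->]]; last first.
    by rewrite mem_edges // set21.
  case/imsetP=> -[x y]; rewrite inE /= => exy -> {s}.
  rewrite !inE => /orP[]/eqP->; [exists y|exists x] => //.
    by rewrite inE sym_e.
  by rewrite setUC.
by move=> x y _ _; apply: set2_inj.
Qed.

(** Here [a] labels an edge inside a level, [x] and [y] the edges from its ends to their parents,
    and [R], [B] are the remaining red and blue degrees. If one end already has parity [p], then
    [a = 0] leaves only blue to care for: the parent edge of the other end repairs its parity, and 0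
    or 2 on the free parent edge avoids equality. *)
Lemma pair_choice Ru Rv Bu Bv (p : bool) : exists a x y,
  [/\ [/\ a <= 2, x <= 2 & y <= 2],
     odd (Ru + x + a) = p, odd (Rv + y + a) = p,
     (a != 0 -> Ru + x != Rv + y)
   & (a != 2 -> Bu + (2 - x) != Bv + (2 - y))].
Proof.
case: (eqVneq (odd Ru) p) => [<-|pu].
  have [y y2 oy] : exists2 y, y <= 2 & odd (Rv + y) = odd Ru.
    exists (odd Rv (+) odd Ru : nat); first by case: (_ (+) _).
    by rewrite oddD oddb addbA addbb.
  have [H|H] := eqVneq (Bu + 2) (Bv + (2 - y)).
    exists 0, 2, y; split; rewrite ?addn0 ?oy ?oddD ?addbF // => _; lia.
  by exists 0, 0, y; split; rewrite ?addn0.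
case: (eqVneq (odd Rv) p) => [Ep|pv].
  subst p.
  case: (eqVneq (Bu + (2 - 1)) (Bv + (2 - 0))) => [H|H].
    exists 0, 1, 2; split; rewrite ?addn0 ?oddD ?addbF //=; last by move=> _; lia.
    by case: odd pu => //; case: odd.
  exists 0, 1, 0; split; rewrite ?addn0 ?oddD //=.
  by case: odd pu => //; case: odd.
have odd1 R k : odd R != p -> ~~ odd k -> odd (R + k + 1) = p.
  by rewrite addn1 /= oddD => /[swap] /negbTE->; case: odd; case: (p).
(* Both parities are wrong, so [a = 1] repairs both. The pairs (0, 0), (2, 0), (0, 2) for [x] and
   [y] give three distinct degree differences in each color, so each color forbids at most one pair
   and one survives. *)
have [H|H1] := boolP ((Ru + 0 != Rv + 0) && (Bu + 2 != Bv + 2)).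
  by case/andP: H => H1 H2; exists 1, 0, 0; split=> //; apply: odd1.
have [H|H2] := boolP ((Ru + 2 != Rv + 0) && (Bu + 0 != Bv + 2)).
  by case/andP: H => H3 H4; exists 1, 2, 0; split=> //; apply: odd1.
by exists 1, 0, 2; split=> //; rewrite ?odd1 // => _; lia.
Qed.

(** Induction on [Q]: take out a vertex of least level, with its partner in that level if there is
    one. By minimality the parents lie outside [Q], so relabelling the parent edges and the edge
    between the partners changes no sum at the rest of [Q]. *)
Lemma parity_labelling e (l : T -> nat) (par : T -> T) (col : nat -> bool)
    (Q : {set T}) :
  symmetric e -> irreflexive e ->
  {in Q, forall u, e u (par u) /\ l (par u) < l u} ->
  {in Q & &, forall u v w, e u v -> e u w -> l u = l v -> l u = l w -> v = w} ->
  exists2 m, forall s, m s <= 2 &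
    {in Q, forall u, odd (esum e m u) = col (l u)} /\
    {in Q &, forall u v, e u v -> l u = l v -> good e m u v}.
Proof.
move=> sym_e irr_e; have [n] := ubnP #|Q|; elim: n Q => // n IH Q cardQ parQ matchQ.
have [->|[u0 u0Q]] := set_0Vmem Q.
  by exists (fun=> 0) => //; split=> [u|u v]; rewrite inE.
case: (@arg_minnP _ u0 (fun i => i \in Q) l u0Q) => u uQ min_u.
have [eup lup] := parQ _ uQ.
have notQ x : x \in Q -> l (par x) < l u -> par x \notin Q.
  by move=> xQ lt; apply: contraL lt => /min_u; rewrite -leqNgt.
have IHsub (A : {set T}) : u \in A -> exists2 m, forall s, m s <= 2 &
    {in Q :\: A, forall v, odd (esum e m v) = col (l v)} /\
    {in Q :\: A &, forall v w, e v w -> l v = l w -> good e m v w}.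
  move=> uA; apply: IH.
  - rewrite ltnS in cardQ; apply: leq_trans cardQ; apply: proper_card.
    rewrite properE subsetDl; apply/subsetPn.
    by exists u; rewrite // !inE uA.
  - by move=> v /setDP[/parQ].
  - by move=> v w x /setDP[vQ _] /setDP[wQ _] /setDP[xQ _]; apply: matchQ.
have [v /and3P[vQ euv /eqP luv]|alone] :=
    pickP [pred v | [&& v \in Q, e u v & l u == l v]].
  have [evp lvp] := parQ _ vQ.
  have [m m2 [oddm goodm]] := IHsub [set u; v] (set21 _ _).
  have vpQ : par v \notin Q by rewrite notQ // luv.
  have upQ : par u \notin Q by rewrite notQ.
  have nuv : u != v by apply: contraTneq euv => ->; rewrite irr_e.
  have pun : par u != v by apply: contraNneq upQ => ->.
  have pvn : par v != u by apply: contraNneq vpQ => ->.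
  have sum_u F a x y :
      esum e (upd u v a (upd u (par u) x (upd v (par v) y F))) u =
      esum e (upd u v 0 (upd u (par u) 0 F)) u + x + a.
    rewrite -esum_upd2 //; last by rewrite eq_sym.
    apply: esum_local => s us; rewrite /upd; do 2 case: eqP => // _.
    by case: eqP us => // ->; rewrite !inE (negbTE nuv) eq_sym (negbTE pvn).
  have sum_v F a x y :
      esum e (upd u v a (upd u (par u) x (upd v (par v) y F))) v =
      esum e (upd v u 0 (upd v (par v) 0 F)) v + y + a.
    rewrite -esum_upd2 //; [|by rewrite sym_e|by rewrite eq_sym].
    apply: esum_local => s vs; rewrite /upd setUC; case: eqP => // _.
    by case: eqP vs => // ->; rewrite !inE eq_sym (negbTE nuv) eq_sym (negbTE pun).
  have notin w : w \in Q -> w \notin [set u; v] ->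
      w \notin [set u; par u] /\ w \notin [set v; par v].
    move=> wQ; rewrite !inE !negb_or => /andP[-> ->] /=.
    by split; [apply: contraNneq upQ => <-|apply: contraNneq vpQ => <-].
  (* The four sums are the red and blue degrees without the edge [uv] and the parent edges. *)
  have [a [x [y [[a2 x2 y2] pu pv redP bluP]]]] := pair_choice
    (esum e (upd u v 0 (upd u (par u) 0 m)) u)
    (esum e (upd v u 0 (upd v (par v) 0 m)) v)
    (esum e (upd u v 0 (upd u (par u) 0 (co m))) u)
    (esum e (upd v u 0 (upd v (par v) 0 (co m))) v) (col (l u)).
  pose m' := upd u v a (upd u (par u) x (upd v (par v) y m)).
  have co_m' : co m' =1
      upd u v (2 - a) (upd u (par u) (2 - x) (upd v (par v) (2 - y) (co m))).
    by move=> s; rewrite /m' /co /upd; do 3 case: eqP => // _.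
  have good_uv : good e m' u v.
    rewrite /good !(eq_esum _ _ co_m') !sum_u !sum_v !eqn_add2r.
    have ->: m' [set u; v] = a by rewrite /m' /upd eqxx.
    by apply/andP; split; apply/implyP.
  exists m' => [s|].
    by rewrite /m' /upd; do 3 case: eqP => // _.
  split=> [w wQ|w z wQ zQ ewz lwz].
    have [wuv|wuv] := boolP (w \in [set u; v]).
      move: wuv; rewrite !inE => /orP[]/eqP->; first by rewrite sum_u.
      by rewrite sum_v -luv.
    have [wu wv] := notin _ wQ wuv.
    by rewrite !esum_upd_notin // oddm // inE wuv.
  have [wu|wu] := eqVneq w u.
    by subst w; rewrite (matchQ u z v).
  have [wv|wv] := eqVneq w v.
    by subst w; rewrite good_sym (matchQ v z u) // sym_e.
  have [zu|zu] := eqVneq z u.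
    by subst z; case/eqP: wv; apply: (matchQ u) => //; rewrite sym_e.
  have [zv|zv] := eqVneq z v.
    by subst z; case/eqP: wu; apply: (matchQ v) => //; rewrite sym_e.
  have wuv : w \notin [set u; v] by rewrite !inE negb_or wu.
  have zuv : z \notin [set u; v] by rewrite !inE negb_or zu.
  have [w1 w2] := notin _ wQ wuv; have [z1 z2] := notin _ zQ zuv.
  have := goodm w z; rewrite !in_setD wuv zuv => /(_ wQ zQ ewz lwz).
  rewrite /good !(eq_esum _ _ co_m') !esum_upd_notin //.
  suff ->: m' [set w; z] = m [set w; z] by [].
  rewrite /m' /upd; have := set21 w z.
  case: eqP => [->|_]; first by rewrite (negbTE wuv).
  case: eqP => [->|_]; first by rewrite (negbTE w1).
  by case: eqP => [->|_]; first by rewrite (negbTE w2).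
have [m m2 [oddm goodm]] := IHsub [set u] (set11 _).
have upQ : par u \notin Q by rewrite notQ.
(* No edge inside the level meets [u] within [Q], so only its parity has to be corrected, by 0 or
   1. *)
pose k := (odd (esum e (upd u (par u) 0 m) u) (+) col (l u) : nat).
exists (upd u (par u) k m) => [s|].
  by rewrite /upd; case: eqP => // _; rewrite /k; case: (_ (+) _).
have notin v : v \in Q -> v != u -> v \notin [set u; par u].
  move=> vQ vu; rewrite !inE negb_or vu /=.
  by apply: contraNneq upQ => <-.
split=> [v vQ|v w vQ wQ evw lvw].
  have [->|vu] := eqVneq v u.
    rewrite esum_upd_in ?mem_edges ?set21 // oddD oddb addbA addbb //.
  by rewrite esum_upd_notin ?notin // oddm // !inE vu.
have [vu|vu] := eqVneq v u.
  by have := alone w; rewrite /= wQ -vu evw lvw eqxx.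
have [wu|wu] := eqVneq w u.
  by have := alone v; rewrite /= vQ sym_e -wu evw lvw eqxx.
have := goodm v w; rewrite !inE vu wu => /(_ vQ wQ evw lvw).
rewrite /good !(eq_esum _ _ (co_upd _ _ _ _)) !esum_upd_notin ?notin //.
suff ->: upd u (par u) k m [set v; w] = m [set v; w] by [].
rewrite /upd; case: eqP => // E.
by have := set21 v w; rewrite E (negbTE (notin _ vQ vu)).
Qed.

End EdgeSums.

(** * Vertex deletion, breadth-first search, and labellings for odd order *)

Section Connectivity.
Variable T : finType.
Implicit Types (e : rel T) (D : {set T}).

(** The deleted vertex stays in the type as an isolated vertex. *)
Definition del e w : rel T := fun x y => [&& e x y, x != w & y != w].

Lemma del_sym e w : symmetric e -> symmetric (del e w).
Proof. by move=> sym_e x y; rewrite /del sym_e (andbC (x != w)). Qed.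

Lemma del_irrefl e w : irreflexive e -> irreflexive (del e w).
Proof. by move=> irr_e x; rewrite /del irr_e. Qed.

Lemma bfs_levels e r : symmetric e -> exists (l : T -> nat) (par : T -> T),
  [/\ l r = 0,
      forall v, connect e r v -> v != r ->
        [/\ e v (par v), connect e r (par v) & l v = (l (par v)).+1]
    & forall u v, connect e r u -> e u v -> l v <= (l u).+1].
Proof.
move=> sym_e.
pose walk v n := [exists p : n.-tuple T, path e r p && (last r p == v)].
have walkP p : path e r p -> walk (last r p) (size p).
  by move=> ep; apply/existsP; exists (in_tuple p); rewrite ep eqxx.
(* The implication makes the level total: unreachable vertices get level 0. *)
have ex v : exists n, connect e r v ==> walk v n.
  have [/connectP[p ep ->]|] := boolP (connect e r v); last by exists 0.
  by exists (size p); apply/implyP=> _; apply: walkP.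
pose l v := ex_minn (ex v).
have lP v : connect e r v ->
    exists p, [/\ path e r p, last r p = v & size p = l v].
  rewrite /l; case: ex_minnP => n /implyP + _ => /[apply] /existsP[p].
  by case/andP=> ep /eqP <-; exists p; rewrite size_tuple.
have l_min p : path e r p -> l (last r p) <= size p.
  rewrite /l; case: ex_minnP => n _ n_min ep.
  by apply: n_min; rewrite walkP ?implybT.
have step u v : connect e r u -> e u v -> l v <= (l u).+1.
  move=> /lP[p [ep <- <-]] euv.
  by have := l_min (rcons p v); rewrite last_rcons size_rcons rcons_path ep; apply.
pose P v := [pred u | [&& e v u, connect e r u & l v == (l u).+1]].
exists l, (fun v => odflt v [pick u | P v u]); split=> //.
  by apply/eqP; rewrite -leqn0; apply: (l_min [::]).
move=> v rv vr; case: pickP => [u /and3P[-> -> /eqP//]|noP].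
have [p [ep lp sp]] := lP v rv; case/lastP: p ep lp sp => [|p x].
  by move=> _ rE; rewrite -rE eqxx in vr.
rewrite rcons_path last_rcons size_rcons => /andP[ep ex'] xv sp; subst x.
have ru : connect e r (last r p) by apply/connectP; exists p.
have := noP (last r p); rewrite /= sym_e ex' ru eqn_leq step //=.
by rewrite -sp ltnS l_min.
Qed.

(** The chain of parents from [x] to the root has strictly decreasing levels. It starts at another
    vertex than [u], no higher than [u], hence never meets [u]. *)
Lemma connect_del_lower e (l : T -> nat) (par : T -> T) r u x :
  symmetric e ->
  (forall v, connect e r v -> v != r ->
     [/\ e v (par v), connect e r (par v) & l v = (l (par v)).+1]) ->
  connect e r x -> x != u -> l x <= l u -> connect (del e u) x r.
Proof.
move=> sym_e parP; have [n] := ubnP (l x); elim: n x => // n IH x lxn rx xu lxu.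
have [->|xr] := eqVneq x r; first exact: connect0.
have [exp rp lx] := parP x rx xr.
have lpx : l (par x) < l x by rewrite lx.
have pu : par x != u by apply: contraTneq lxu => <-; rewrite -ltnNge.
apply: connect_trans (connect1 _) (IH _ _ rp pu _); first by rewrite /del exp xu.
  by rewrite ltnS in lxn; apply: leq_trans lxn.
exact: ltnW (leq_trans lpx lxu).
Qed.

(** The form in which the cactus property is used: each component left after deleting [u] contains
    at most two neighbours of [u]. Unlike a statement about cycles, it passes to [del e w] at
    once. *)
Definition no_triple e := forall u x y z, e u x -> e u y -> e u z ->
  connect (del e u) x y -> connect (del e u) x z -> x != y -> x != z -> y = z.

(** [D] is the vertex set, which leaves room for a deleted vertex in the type. Parities can agree
    only on edges inside a level. For these the conclusion also records that [v] and the parent [p]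
    of [u] reach the root without [u]; this limits the further neighbours of [u] once a deleted
    vertex is put back. *)
Lemma odd_order_labelling e D r : symmetric e -> irreflexive e ->
  no_triple e -> r \in D -> {in D, forall x, connect e r x} ->
  (forall x y, e x y -> x \in D) -> odd #|D| ->
  exists2 m, forall s, m s <= 2 & forall u v, e u v ->
    odd (esum e m u) = odd (esum e m v) ->
    [/\ good e m u v, u != r & exists p,
        [/\ e u p, p != v, connect (del e u) v r & connect (del e u) p r]].
Proof.
move=> sym_e irr_e no3 rD conn supp odd_D.
have [l [par [lr parP step]]] := bfs_levels r sym_e.
(* The parity of the number of vertices on odd levels. If it is odd, all demands are flipped; as the
   order is odd, the number of odd demands becomes even. *)
pose c := \big[addb/false]_(u in D) odd (l u).
pose col n := odd n (+) c.
have sum_col : \big[addb/false]_(u in D) col (l u) = false.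
  rewrite big_split /= -/c.
  suff ->: \big[addb/false]_(u in D) c = c by rewrite addbb.
  have iterP n : iter n (addb c) false = odd n && c.
    by elim: n => //= n ->; case: odd; case: (c).
  by rewrite big_const iterP odd_D.
have low u v : e u v -> l u = l v -> connect (del e u) v r.
  move=> euv luv; apply: connect_del_lower parP _ _ _ => //.
  - by apply/conn/(supp _ u); rewrite sym_e.
  - by apply: contraTneq euv => ->; rewrite irr_e.
  - by rewrite luv.
have up u : connect e r u -> u != r ->
    [/\ e u (par u), l (par u) < l u & connect (del e u) (par u) r].
  move=> ru ur; have [eup rp lup] := parP u ru ur; split=> //; first by rewrite lup.
  apply: connect_del_lower parP rp _ _ => //; last by rewrite lup.
  by apply: contraTneq eup => ->; rewrite irr_e.
have [||m m2 [oddm goodm]] := @parity_labelling T e l par col (D :\ r) sym_e irr_e.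
- by move=> u /setD1P[ur /conn ru]; have [] := up u ru ur.
- move=> u v w /setD1P[ur /conn ru] _ _ euv euw luv luw.
  have [eup lup pr] := up u ru ur.
  (* Two neighbours of [u] in its level and its parent would be three neighbours joined through the
     root in the absence of [u]. *)
  apply: (no3 u (par u)) => //.
  + by rewrite (connect_trans pr) // (sym_connect_sym (del_sym u sym_e)) ?low.
  + by rewrite (connect_trans pr) // (sym_connect_sym (del_sym u sym_e)) ?low.
  + by apply: contraTneq lup => ->; rewrite -luv ltnn.
  + by apply: contraTneq lup => ->; rewrite -luw ltnn.
exists m => //.
have odd_sum u : u \in D -> odd (esum e m u) = col (l u).
  have [->{u} _|ur uD] := eqVneq u r; last by rewrite oddm // !inE ur.
  have := handshake m sym_e irr_e.
  rewrite (bigID (mem D)) /= [X in _ + X]big1 ?addn0; last first.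
    move=> v vD; rewrite esum_nbr // big1 // => w evw.
    by rewrite (supp _ _ evw) in vD.
  rewrite (big_morph odd oddD (erefl : odd 0 = false)).
  move/negbTE=> E; move: (etrans E (esym sum_col)).
  rewrite 2!(bigD1 r rD) /=.
  rewrite (eq_bigr (fun v => col (l v))) => [/addIb//|v /andP[vD vr]].
  by rewrite oddm // !inE vr.
move=> u v euv.
have uD : u \in D := supp _ _ euv.
have vD : v \in D by apply: (supp _ u); rewrite sym_e.
rewrite !odd_sum // => /addIb odd_uv.
(* Levels of adjacent vertices differ by at most one, so equal parity forces equal levels. *)
have luv : l u = l v.
  have := step u v (conn _ uD) euv.
  have := step v u (conn _ vD); rewrite sym_e => /(_ euv).
  move: odd_uv; case: (ltngtP (l u) (l v)) => // lt Eo.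
    move=> _ le; move: Eo; rewrite (_ : l v = (l u).+1) /=; first by case: odd.
    by apply/eqP; rewrite eqn_leq le.
  move=> le _; move: Eo; rewrite (_ : l u = (l v).+1) /=; first by case: odd.
  by apply/eqP; rewrite eqn_leq le.
have pos x : x \in D -> x != r -> 0 < l x.
  by move=> xD xr; have [_ _ ->] := parP x (conn x xD) xr.
have ur : u != r.
  apply: contraTneq euv => E; have [->|vr] := eqVneq v r; first by rewrite E irr_e.
  by have := pos _ vD vr; rewrite -luv E lr.
have vr : v != r.
  by apply: contraTneq (pos _ uD ur) => E; rewrite luv E lr.
have [eup lup pr] := up u (conn u uD) ur.
split=> //; first by apply: goodm; rewrite ?inE ?ur ?vr.
exists (par u); split=> //; last exact: low.
by apply: contraTneq lup => ->; rewrite luv ltnn.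
Qed.

End Connectivity.

(** * The cactus property *)

(** Simple paths from [x] to [y] and from [x] to [z] avoiding [v] close up through [v] to two cycles
    that share [v] and [x]. If [y] and [z] differ, so do the cycles. *)
Lemma cactus_no_triple (G : sgraph) : cactus G -> no_triple (@sadj G).
Proof.
move=> cacG v x y z vx vy vz xy xz nxy nxz.
have detour t : sadj v t -> x != t -> connect (del (@sadj G) v) x t ->
    exists2 p, is_cycle [:: v, x & p] & last x p = t.
  move=> vt nxt /connectP[p0 ep0 tE].
  case: (shortenP ep0) tE => p ep uniq_p _ tE; exists p => //.
  split.
    by case: p ep uniq_p tE => //= _ _ E; rewrite E eqxx in nxt.
  have vp : v \notin x :: p.
    have vx' : v != x by apply: contraTneq vx => ->; rewrite sadj_irrefl.
    rewrite inE negb_or vx' /= {tE uniq_p vx vx'}.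
    elim: p x ep {xy xz nxy nxz nxt ep0} => //= s p IH x /andP[/and3P[_ _ sv] /IH].
    by rewrite inE negb_or eq_sym sv.
  apply/andP; split; last by rewrite cons_uniq vp.
  rewrite /= vx rcons_path -tE sadj_sym vt andbT.
  by apply: sub_path ep => a b /and3P[].
apply/eqP; apply: contraT => nyz.
have [p cp lp] := detour y vy nxy xy; have [q cq lq] := detour z vz nxz xz.
suff ne : cycle_edges [:: v, x & p] <> cycle_edges [:: v, x & q].
  have := cacG _ _ cp cq ne; rewrite leqNgt => /negP[].
  have vx' : v != x by apply: contraTneq vx => ->; rewrite sadj_irrefl.
  apply: (@leq_trans #|[set v; x]|); first by rewrite cards2 vx'.
  by apply/subset_leq_card/subsetP=> t; rewrite !inE => /orP[]->; rewrite ?orbT.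
have prev_head t s : uniq [:: v, x & s] -> last x s = t ->
    prev [:: v, x & s] v = t.
  rewrite cons_uniq => /andP[vs _] <-.
  rewrite prev_nth mem_head (memNindex vs).
  by rewrite -[size _]/(size [:: v, x & s]).-1 nth_last.
have [_ /andP[_ Uc]] := cp; have [_ /andP[_ Uq]] := cq.
have prevp : prev [:: v, x & p] v = y by apply: prev_head.
have prevq : prev [:: v, x & q] v = z by apply: prev_head.
(* The edge [vz] tells the cycles apart: the first one meets [v] only in the edges [vx] and [vy]. *)
move=> E; have : [set v; z] \in cycle_edges [:: v, x & p].
  rewrite E setUC; apply/imsetP; exists z; first by rewrite -prevq mem_prev mem_head.
  by have := next_prev Uq v; rewrite prevq => ->.
case/imsetP=> t _ Et.
have := set21 t (next [:: v, x & p] t); rewrite -Et !inE => /orP[]/eqP tE; subst t.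
  by have := set2_inj Et; rewrite /= eqxx => zx; rewrite zx eqxx in nxz.
rewrite setUC in Et; have := set2_inj Et => vE.
by have := prev_next Uc z; rewrite -vE prevp => yz; rewrite yz eqxx in nyz.
Qed.

(** * Even order: adding back a deleted vertex *)

Section Extension.
Variable T : finType.
Implicit Types (e : rel T) (F m : {set T} -> nat).

Lemma esum_del e F v w : symmetric e -> v != w ->
  esum e F v = esum (del e w) F v + (if e v w then F [set v; w] else 0).
Proof.
move=> sym_e vw; rewrite !esum_nbr //; last exact: del_sym.
rewrite (bigID (pred1 w)) /= addnC; congr (_ + _).
  by apply: eq_bigl => u; rewrite /del vw.
case: ifP => evw; last first.
  by rewrite big_pred0 // => u; case: eqP => [->|_]; rewrite ?evw ?andbF.
rewrite (big_pred1 w) // => u /=.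
by case: eqP => [->|_]; rewrite ?evw ?andbF.
Qed.

Lemma esum_add_co_gt0 e m v u : symmetric e -> e v u ->
  0 < esum e m v + esum e (co m) v.
Proof.
move=> sym_e evu; rewrite -big_split /= (bigD1 [set v; u]) /=; last first.
  by rewrite mem_edges // evu set21.
by rewrite /co; case: (m _).
Qed.

(** For a removed vertex with one neighbour, whose other edges give [R] and [B]: label 2 works if
    [R] is positive, label 0 if [B] is. *)
Lemma star1_choice R B : 0 < R + B -> exists k,
  [/\ k = 0 \/ k = 2, (k != 0 -> k != R + k)
    & (k != 2 -> 2 - k != B + (2 - k))].
Proof. by case: R => [|R] RB; [exists 0|exists 2]; split; auto; lia. Qed.

(** For two neighbours. If (0, 0) and (2, 2) both fail, some blue and some red degree equal 2. If
    (2, 0) fails too, [Ra] or [Bb] is 0; either way [Rb] and [Ba] are positive, and (0, 2) works. *)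
Lemma star2_choice Ra Ba Rb Bb : 0 < Ra + Ba -> 0 < Rb + Bb -> exists ka kb,
  [/\ ka = 0 \/ ka = 2, kb = 0 \/ kb = 2,
     (ka != 0 -> ka + kb != Ra + ka) /\
       (ka != 2 -> (2 - ka) + (2 - kb) != Ba + (2 - ka))
   & (kb != 0 -> ka + kb != Rb + kb) /\
       (kb != 2 -> (2 - ka) + (2 - kb) != Bb + (2 - kb))].
Proof.
move=> a b.
have [H|H1] := boolP ((Ba != 2) && (Bb != 2)).
  by exists 0, 0; split; auto; lia.
have [H|H2] := boolP ((Ra != 2) && (Rb != 2)).
  by exists 2, 2; split; auto; lia.
have [H|H3] := boolP ((Ra != 0) && (Bb != 0)).
  by exists 2, 0; split; auto; lia.
by exists 0, 2; split; auto; lia.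
Qed.

(** Labels 0 and 2 at [w] keep all red parities in the rest of the graph. Edges there with ends of
    equal parity have no end adjacent to [w], so the degrees at their ends do not change, and only
    the edges at [w] remain to be made good. *)
Lemma even_order_labelling e : symmetric e -> irreflexive e -> no_triple e ->
  (forall x y, connect e x y) -> ~~ odd #|T| -> 2 < #|T| ->
  exists2 m, forall s, m s <= 2 & forall u v, e u v -> good e m u v.
Proof.
move=> sym_e irr_e no3 conn evenT T3.
have [r0 _] : exists r0 : T, true.
  by case: (pickP (mem T)) => [x _|/eq_card0 T0]; [exists x|rewrite T0 in T3].
have [l [par [_ parP _]]] := bfs_levels r0 sym_e.
(* A vertex of maximal level is not a cut vertex: all others reach the root along parents without
   it. *)
case: (@arg_maxnP _ r0 xpredT l isT) => w _ max_w.
have sym_d x := sym_connect_sym (del_sym x sym_e).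
have connD x y : x != w -> y != w -> connect (del e w) x y.
  move=> xw yw; apply: (@connect_trans _ _ r0); last rewrite sym_d.
    by apply: connect_del_lower parP _ _ _ => //; apply: max_w.
  by apply: connect_del_lower parP _ _ _ => //; apply: max_w.
have nbr (f : rel T) x y : connect f x y -> x != y -> exists z, f x z.
  move=> /connectP[[|z p] /= fp ->]; first by rewrite eqxx.
  by exists z; case/andP: fp.
have other (x y : T) : exists2 z, z != x & z != y.
  have /set0Pn[z] : [set~ x] :\ y != set0.
    have : 1 < #|[set~ x]| by rewrite cardsC1 -ltnS prednK // ltnW // ltnW.
    rewrite -card_gt0 (cardsD1 y [set~ x]).
    by case: (y \in [set~ x]) => //= /ltnW.
  by rewrite !inE => /andP[]; exists z.
have [a ewa] : exists a, e w a.
  by have [t tw _] := other w w; apply: (nbr e w t) => //; rewrite eq_sym.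
have nw x : e w x -> x != w by apply: contraTneq => ->; rewrite irr_e.
have nwd u v : del e w u v -> [/\ e u v, u != w & v != w] by case/and3P.
have aw := nw a ewa.
have sym_e' : symmetric (del e w) := del_sym w sym_e.
have sub_del u x y : connect (del (del e w) u) x y -> connect (del e u) x y.
  apply: connect_sub => {x y} x y /and3P[/nwd[exy _ _] xu yu].
  by apply: connect1; rewrite /del exy xu.
have [m m2 goodm] : exists2 m, forall s, m s <= 2 & forall u v, del e w u v ->
    odd (esum (del e w) m u) = odd (esum (del e w) m v) ->
    [/\ good (del e w) m u v, u != a & exists p,
        [/\ del e w u p, p != v, connect (del (del e w) u) v a
          & connect (del (del e w) u) p a]].
  apply: (@odd_order_labelling _ _ [set~ w]) => //.
  - exact: del_irrefl.
  - move=> u x y z /nwd[ux _ _] /nwd[uy _ _] /nwd[uz _ _] /sub_del xy /sub_del xz.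
    exact: no3 xy xz.
  - by rewrite !inE.
  - by move=> x; rewrite !inE => xw; apply: connD.
  - by move=> x y /nwd[_ xw _]; rewrite !inE.
  - by rewrite cardsC1; move: evenT; case: #|T| T3 => //= n _; rewrite negbK.
have degp x : e w x -> 0 < esum (del e w) m x + esum (del e w) (co m) x.
  move=> ewx; have [t tw tx] := other w x.
  have [z ez] : exists z, del e w x z.
    by apply: (nbr _ x t); [apply: connD => //; apply: nw|rewrite eq_sym].
  exact: esum_add_co_gt0 ez.
have not_nbr u v : del e w u v ->
    odd (esum (del e w) m u) = odd (esum (del e w) m v) -> ~~ e u w.
  (* Otherwise [v], [p] and [w] are neighbours of [u] that all reach [a] without [u], the last by
     the edge [wa]; then [p = w], which is absurd. *)
  move=> uv /(goodm u v uv)[_ ua [p [up pv va pa]]].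
  have [euv uw vw] := nwd _ _ uv; have [eup _ pw] := nwd _ _ up.
  apply: contra pw => euw; apply/eqP; apply: (no3 u v) => //; last by rewrite eq_sym.
    by apply/sub_del; rewrite (connect_trans va) //
      (sym_connect_sym (del_sym u sym_e')).
  apply: connect_trans (sub_del _ _ _ va) (connect1 _).
  by rewrite /del sym_e ewa !(eq_sym _ u) ua uw.
suff [m' [m'2 m'E m'02 m'good]] : exists m', [/\ forall s, m' s <= 2,
    forall s : {set T}, w \notin s -> m' s = m s,
    forall v, e w v -> m' [set v; w] = 0 \/ m' [set v; w] = 2
  & forall v, e w v -> good e m' w v].
  exists m' => // u v euv.
  have [uw|uw] := eqVneq u w; first by subst u; apply: m'good.
  have [vw|vw] := eqVneq v w; first by rewrite good_sym vw m'good // sym_e -vw.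
  have locE F F' x : (forall s : {set T}, w \notin s -> F s = F' s) -> x != w ->
      esum (del e w) F x = esum (del e w) F' x.
    move=> FE xw; rewrite !esum_nbr //; apply: eq_bigr => y /nwd[_ _ yw].
    by apply: FE; rewrite !inE negb_or !(eq_sym w) xw.
  have euv' : del e w u v by rewrite /del euv uw.
  have oddE x : x != w -> odd (esum e m' x) = odd (esum (del e w) m x).
    move=> xw; rewrite (esum_del _ sym_e xw) (locE _ _ _ m'E xw) oddD.
    by case: ifP => [|_]; [rewrite sym_e => /m'02[]->|]; rewrite addbF.
  have [odd_uv|] :=
    eqVneq (odd (esum (del e w) m u)) (odd (esum (del e w) m v)); last first.
    by move=> odd_uv; apply: good_odd; rewrite ?oddE.
  have [] := goodm u v euv' odd_uv.
  have coE (s : {set T}) : w \notin s -> co m' s = co m s.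
    by move=> ws; rewrite /co m'E.
  rewrite /good !(esum_del _ sym_e uw) !(esum_del _ sym_e vw).
  have uvw : w \notin [set u; v] by rewrite !inE negb_or !(eq_sym w) uw.
  rewrite !(locE _ _ _ m'E) // !(locE _ _ _ coE) // m'E //.
  rewrite (negbTE (not_nbr _ _ euv' odd_uv)).
  by rewrite (negbTE (not_nbr v u _ _)) // ?addn0 // sym_e'.
(* [ka] goes to the edge [wa], [kb] to any other edge at [w]. *)
pose lab ka kb (s : {set T}) := if w \in s then (if a \in s then ka else kb) else m s.
have lab_a ka kb : lab ka kb [set a; w] = ka by rewrite /lab set22 set21.
have lab_b ka kb b : b != a -> lab ka kb [set b; w] = kb.
  by move=> ba; rewrite /lab set22 !inE !(eq_sym a) (negbTE ba) eq_sym (negbTE aw).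
have lab_m ka kb (s : {set T}) : w \notin s -> lab ka kb s = m s.
  by rewrite /lab => /negbTE->.
have lab_x ka kb x : e w x ->
     esum e (lab ka kb) x = esum (del e w) m x + lab ka kb [set x; w] /\
     esum e (co (lab ka kb)) x = esum (del e w) (co m) x + (2 - lab ka kb [set x; w]).
  move=> ewx; have xw := nw _ ewx; rewrite !(esum_del _ sym_e xw) sym_e ewx.
  rewrite !esum_nbr //; split; congr (_ + _); apply: eq_bigr => y /nwd[_ _ yw].
    by rewrite lab_m // !inE negb_or !(eq_sym w) xw.
  by rewrite /co lab_m // !inE negb_or !(eq_sym w) xw.
have [b /andP[ewb ba]|only_a] := pickP [pred b | e w b && (b != a)].
  have ab : a != b by rewrite eq_sym.
  have nbrs x : e w x = (x == a) || (x == b).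
    apply/idP/orP=> [ewx|[]/eqP->//].
    have [xa|xa] := eqVneq x a; first by left.
    (* The graph without [w] is connected, so a third neighbour of [w] is impossible. *)
    right; apply/eqP; apply: (no3 w a); rewrite ?connD ?nw // eq_sym.
    by [].
  have [ka [kb [ka02 kb02 [a1 a2] [b1 b2]]]] :=
    star2_choice (degp a ewa) (degp b ewb).
  exists (lab ka kb).
  have sum_w F : esum e F w = F [set a; w] + F [set b; w].
    rewrite esum_nbr // (bigD1 a) //= (bigD1 b) ?ewb //= big_pred0 ?addn0.
      by rewrite ![[set w; _]]setUC.
    by move=> x; rewrite nbrs; case: (x == a); case: (x == b).
  split=> // [s||v|v].
  - rewrite /lab; case: ifP => // _; case: ifP => _.
      by case: ka02 => ->.
    by case: kb02 => ->.
  - by move=> s; apply: lab_m.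
  - by rewrite nbrs => /orP[]/eqP->; rewrite ?lab_a ?lab_b.
  rewrite nbrs /good [[set w; _]]setUC => /orP[]/eqP->.
    have [-> ->] := lab_x ka kb a ewa; rewrite !sum_w /co lab_a lab_b //.
    by apply/andP; split; apply/implyP.
  have [-> ->] := lab_x ka kb b ewb; rewrite !sum_w /co lab_a lab_b //.
  by apply/andP; split; apply/implyP.
have nbrs x : e w x = (x == a).
  by apply/idP/eqP=> [ewx|->//]; have := only_a x; rewrite /= ewx => /eqP.
have [k [k02 a1 a2]] := star1_choice (degp a ewa).
exists (lab k k).
have sum_w F : esum e F w = F [set a; w].
  rewrite esum_nbr // (big_pred1 a) //; first by rewrite setUC.
split=> // [s||v|v].
- rewrite /lab; case: ifP => // _; case: ifP => _.
    by case: k02 => ->.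
  by case: k02 => ->.
- by move=> s; apply: lab_m.
- by rewrite nbrs => /eqP->; rewrite lab_a.
rewrite nbrs /good [[set w; _]]setUC => /eqP->.
have [-> ->] := lab_x k k a ewa; rewrite !sum_w /co lab_a.
by apply/andP; split; apply/implyP.
Qed.

End Extension.

(** * From labellings to colorings of the doubled graph *)

Section Coloring.
Variable G : sgraph.

(** Degrees in a color class become sums of labels. A label takes an arbitrary vertex set, while
    single edges carry a proof of being an edge; hence the existential. *)
Lemma mdeg_submgraph (A : {set medge (doubling G)}) (v : G) :
  @mdeg (submgraph A) v = esum (@sadj G)
    (fun s => \sum_(b : bool) [exists d in A, (val d.1 == s) && (d.2 == b)]) v.
Proof.
rewrite /mdeg -(card_imset _ val_inj) /esum.
set X := (X in #|X|).
have XE s b : ((s, b) \in X) = ((s, b) \in A) && (v \in val s).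
  apply/imsetP/andP=> [[x + sbx]|[sbA vs]]; last first.
    by exists (exist _ (s, b) sbA); rewrite ?inE.
  by rewrite inE /= /sub_ends -sbx => vs; rewrite sbx; split; first exact: (valP x).
rewrite big_mkcondr big_sub -sum1_card big_mkcond /=.
rewrite (eq_bigr (fun d => if (d.1, d.2) \in X then 1 else 0)); last by case.
rewrite -(pair_bigA _ (fun s b => if (s, b) \in X then 1 else 0)) /=.
apply: eq_bigr => s _; case: ifP => vs; last first.
  by rewrite big1 // => b _; rewrite XE vs andbF.
apply: eq_bigr => b _; rewrite XE vs andbT.
suff -> : [exists d in A, (val d.1 == val s) && (d.2 == b)] = ((s, b) \in A).
  by case: (_ \in A).
apply/existsP/idP=> [[[s' b'] /= /and3P[sA /eqP/val_inj <- /eqP <-]]//|sA].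
by exists (s, b); rewrite sA !eqxx.
Qed.

Lemma good_lir_coloring m : (forall s, m s <= 2) ->
  (forall u v : G, sadj u v -> good (@sadj G) m u v) ->
  exists col : {ffun medge (doubling G) -> 'I_2}, lir_coloring col.
Proof.
move=> m2 goodm.
(* [ord0] is red: copy [false] is red for labels 1 and 2, copy [true] only for label 2, so exactly
   [m s] copies are red. *)
pose col := [ffun d : medge (doubling G) =>
  if (d.2 : nat) < m (val d.1) then ord0 else ord_max : 'I_2].
have colE s b c : s \in sedges G ->
    [exists d in [set d | col d == c], (val d.1 == s) && (d.2 == b)] =
    (((b : nat) < m s) == (c == ord0)).
  move=> sE; apply/existsP/idP=> [[[s' b'] /= /and3P[+ /eqP sE' /eqP <-]]|H].
    by rewrite inE ffunE /= sE'; case: ifP => _ /eqP <-.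
  exists (exist _ s sE, b); rewrite inE ffunE /= !eqxx andbT.
  by move: H; case: ifP => _; case: c => [[|[|]]].
exists col; apply/forallP=> c.
pose F := if c == ord0 then m else co m.
have degF v : @mdeg (submgraph [set d | col d == c]) v = esum (@sadj G) F v.
  rewrite mdeg_submgraph; apply: eq_bigr => s /andP[sE _].
  rewrite (bigD1 true) // (bigD1 false) //= big_pred0 ?addn0; last by case.
  rewrite !colE // /F /co; have := m2 s; case: (c == _).
  by case: (m s) => [|[|[]]].
  by case: (m s) => [|[|[]]].
apply/forallP=> u; apply/forallP=> v; apply/implyP=> /existsP[[d dA] /eqP dE].
rewrite !degF.
have uv : sadj u v.
  rewrite -(mem_edges u v (@sadj_sym G)) -dE. exact: (valP d.1).
have /andP[] := goodm u v uv.
have {}dE : val d.1 = [set u; v] by [].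
move: dA; rewrite inE ffunE dE /F.
case: ltnP => [lt|ge] /eqP <- /=.
  by move=> /implyP H _; apply: H; rewrite -lt0n (leq_ltn_trans _ lt).
move=> _ /implyP; apply; apply: contraTneq ge => ->.
by rewrite -ltnNge; case: d.2.
Qed.

End Coloring.

(** * The excluded graph of order 2, and the conclusion *)

Lemma complete2_iso (G : sgraph) :
  connected G -> #|G| = 2 -> sgraph_iso G (complete 2).
Proof.
move=> [_ conn] G2.
have [a _] : exists a : G, true.
  by case: (pickP (mem G)) => [x _|/eq_card0 E]; [exists x|rewrite E in G2].
have /cards1P[b aE] : #|[set~ a]| == 1 by rewrite cardsC1 G2.
have nota x : (x != a) = (x == b) by have := in_set1 x b; rewrite -aE !inE.
have ab : sadj a b.
  have /connectP[[|z p] /= ep E] := conn a b.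
    by have := nota b; rewrite E eqxx.
  case/andP: ep => az _.
  have : z != a by apply: contraTneq az => ->; rewrite sadj_irrefl.
  by rewrite nota => /eqP <-.
pose f x : complete 2 := if x == a then ord0 else ord_max : 'I_2.
have f_neq x y : (f x != f y) = (x != y).
  rewrite /f; have [xa|] := eqVneq x a; have [ya|] := eqVneq y a => //.
  - by rewrite xa ya !eqxx.
  - by rewrite xa eq_sym => ->.
  - by rewrite ya => ->.
  - by rewrite !nota => /eqP-> /eqP->; rewrite !eqxx.
exists f => [|x y].
  apply: inj_card_bij => [x y /eqP|]; last by rewrite card_ord G2.
  by rewrite -[_ == _]negbK f_neq negbK => /eqP.
rewrite [LHS]f_neq; apply/idP/idP=> [|xy]; last first.
  by apply: contraTneq xy => ->; rewrite sadj_irrefl.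
have [->|] := eqVneq x a; first by rewrite eq_sym nota => /eqP->.
rewrite nota => /eqP->; have [-> _|] := eqVneq y a; first by rewrite sadj_sym.
by rewrite nota => /eqP->; rewrite eqxx.
Qed.

Theorem theorem6 (G : sgraph) (Gconn : connected G) (Gcactus : cactus G)
    (GnK2 : ~ sgraph_iso G (complete 2)) :
  exists colG : lir_colorable (doubling G), lir colG <= 2.
Proof.
have [m m2 goodm] : exists2 m, forall s, m s <= 2 &
    forall u v : G, sadj u v -> good (@sadj G) m u v.
  have [G0 conn] := Gconn; have no3 := cactus_no_triple Gcactus.
  have [oddG|evenG] := boolP (odd #|G|).
    have [r _] : exists r : G, true.
      by case: (pickP (mem G)) => [x _|/eq_card0 E]; [exists x|rewrite E in G0].
    have [||||m m2 goodm] := @odd_order_labelling G (@sadj G) setT r (@sadj_sym G)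
        (@sadj_irrefl G) no3; rewrite ?inE ?cardsT //.
    exists m => // u v uv.
    have [/(goodm u v uv)[]//|] :=
      eqVneq (odd (esum (@sadj G) m u)) (odd (esum (@sadj G) m v)).
    exact: good_odd.
  apply: even_order_labelling => //; [exact: sadj_sym|exact: sadj_irrefl|].
  (* The order is even and positive, and order 2 would give the excluded graph. *)
  rewrite ltn_neqAle; apply/andP; split; last by case: #|G| evenG G0 => [|[]].
  by apply/eqP=> G2; apply: GnK2; apply: complete2_iso.
have [col colP] := good_lir_coloring m2 goodm.
have colG : lir_colorable (doubling G) by exists 2; apply/existsP; exists col.
exists colG; rewrite /lir; case: ex_minnP => k _; apply.
by apply/existsP; exists col.
Qed.
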